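(* Let $1\le p<\infty$ and let $w=\{w_n\}_{n\in\mathbb{N}}$ be a bounded sequence of positive real numbers such that the limit $L=\lim_{n\to\infty}w_n$ exists. Let $T$ be either the unilateral weighted forward shift $F_w$ or the unilateral weighted backward shift $B_w$ on $\ell^p(\mathbb{N})$. Then the spectral radius of $T$ is $r(T)=L$.
   Context: $\mathbb{N}$ is the set of positive integers, and $\ell^p(\mathbb{N})$ is the complex Banach space of $p$-summable sequences. The unilateral weighted shifts with weights $w=\{w_n\}_{n\in\mathbb{N}}$ are the bounded operators $F_w(\{x_1,x_2,\dots\})=\{0,w_1x_1,w_2x_2,\dots\}$ and $B_w(\{x_1,x_2,\dots\})=\{w_2x_2,w_3x_3,\dots\}$. The spectral radius is $r(T)=\sup\{|\lambda|:\lambda\in\sigma(T)\}$, where $\sigma(T)$ is the set of $\lambda\in\mathbb{C}$ such that $T-\lambda I$ is not invertible in the algebra of bounded operators. *)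

(* Defs.v *)
From HB Require Import structures.
From mathcomp Require Import all_boot all_order all_algebra.
From mathcomp Require Import complex.
From mathcomp Require Import all_classical all_reals all_analysis.

Set Implicit Arguments.
Unset Strict Implicit.
Unset Printing Implicit Defensive.

Import Order.TTheory GRing.Theory Num.Theory.
Import numFieldNormedType.Exports.

Local Open Scope classical_set_scope.
Local Open Scope ring_scope.
Local Open Scope complex_scope.

Notation cmod := (@ComplexField.Normc.normc _).

Section lp_sequences.
Context {R : realType}.
Implicit Types (p : R) (x y : nat -> R[i]).

Definition lp_sum p x : \bar R := (\sum_(0 <= k <oo) (cmod (x k) `^ p)%:E)%E.

Definition lp_norm p x : R := fine (lp_sum p x) `^ p^-1.

Lemma cmod_ge0 (z : R[i]) : 0 <= cmod z.
Proof. by case: z => a b; exact: sqrtr_ge0. Qed.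

Lemma lp_sum_ge0 p x : (0 <= lp_sum p x)%E.
Proof. by apply: nneseries_ge0 => n _ _; rewrite lee_fin powR_ge0. Qed.

Lemma le_lp_sum p x y : 0 <= p ->
  (forall k, cmod (x k) <= cmod (y k)) -> (lp_sum p x <= lp_sum p y)%E.
Proof.
move=> p0 xy; apply: lee_nneseries => n; first by rewrite lee_fin powR_ge0.
by move=> _; rewrite lee_fin ge0_ler_powR// nnegrE cmod_ge0.
Qed.

Lemma lp_sumZ p (a : R[i]) x :
  lp_sum p (fun k => a * x k) = ((cmod a `^ p)%:E * lp_sum p x)%E.
Proof.
rewrite /lp_sum -nneseriesZl => [|i _]; last by rewrite lee_fin powR_ge0.
by apply: eq_eseriesr => k _; rewrite ComplexField.Normc.normcM powRM ?cmod_ge0.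
Qed.

Lemma lp_sum0 p : 0 < p -> lp_sum p (fun=> 0) = 0%E.
Proof.
move=> p0; apply: eseries0 => k _ _.
by rewrite ComplexField.Normc.normc0 powR0// gt_eqF.
Qed.

Lemma lp_sum_recl p x :
  lp_sum p x = ((cmod (x 0%N) `^ p)%:E + lp_sum p (fun k => x k.+1))%E.
Proof.
rewrite /lp_sum nneseries_recl// => [|k _]; last by rewrite lee_fin powR_ge0.
congr (_ + _)%E.
rewrite (_ : (fun n => _) = fun n =>
    (\sum_(1 <= k < n) (cmod (x k) `^ p)%:E)%E)//.
apply/esym; rewrite -(@nneseries_addn _ (fun k => (cmod (x k) `^ p)%:E) 1).
  by apply: eq_eseriesr => k _; rewrite addn1.
by move=> k; rewrite lee_fin powR_ge0.
Qed.

Lemma lp_enormE p x : 0 < p ->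
  (lp_sum p x `^ p^-1)%E = Lnorm counting p%:E (EFin \o (cmod \o x)).
Proof.
move=> p0; rewrite Lnorm_counting//; congr (_ `^ _)%E.
by apply: eq_eseriesr => k _ /=; rewrite ger0_norm ?cmod_ge0.
Qed.

Lemma lp_normE p x : 0 < p -> (lp_sum p x < +oo)%E ->
  (lp_norm p x)%:E = Lnorm counting p%:E (EFin \o (cmod \o x)).
Proof.
move=> p0 xoo; rewrite -lp_enormE// -[in RHS](@fineK _ (lp_sum p x)).
  by rewrite poweR_EFin.
by rewrite ge0_fin_numE// lp_sum_ge0.
Qed.

Lemma lp_minkowski p x y : 1 <= p ->
  (Lnorm counting p%:E (EFin \o (cmod \o (fun k => x k + y k)%R)) <=
   Lnorm counting p%:E (EFin \o (cmod \o x)) +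
   Lnorm counting p%:E (EFin \o (cmod \o y)))%E.
Proof.
move=> p1; have p0 : 0 < p by rewrite (lt_le_trans _ p1).
apply: le_trans (@minkowski_EFin _ nat _ counting _ _ p _ _ p1) => //.
rewrite !Lnorm_counting//; apply: gt0_ler_poweR; rewrite ?invr_ge0 ?(ltW p0)//.
- by rewrite in_itv/= leey andbT nneseries_ge0// => *; rewrite lee_fin powR_ge0.
- by rewrite in_itv/= leey andbT nneseries_ge0// => *; rewrite lee_fin powR_ge0.
apply: lee_nneseries => k; first by rewrite lee_fin powR_ge0.
move=> _ /=; rewrite lee_fin ge0_ler_powR ?nnegrE ?(ltW p0)//.
rewrite !ger0_norm ?cmod_ge0 ?addr_ge0 ?cmod_ge0//.
exact: le_normcD.
Qed.

Lemma lp_normD p x y : 1 <= p -> (lp_sum p x < +oo)%E ->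
  (lp_sum p y < +oo)%E -> (lp_sum p (fun k => x k + y k)%R < +oo)%E ->
  lp_norm p (fun k => x k + y k) <= lp_norm p x + lp_norm p y.
Proof.
move=> p1 xoo yoo xyoo; have p0 : 0 < p by rewrite (lt_le_trans _ p1).
by have := lp_minkowski x y p1; rewrite -!lp_normE// -EFinD lee_fin.
Qed.

Lemma lp_normZ p (a : R[i]) x : 0 < p -> (lp_sum p x < +oo)%E ->
  lp_norm p (fun k => a * x k) = cmod a * lp_norm p x.
Proof.
move=> p0 xoo; rewrite /lp_norm lp_sumZ fineM//; last first.
  by rewrite ge0_fin_numE ?lp_sum_ge0.
rewrite [fine _%:E]/= powRM ?fine_ge0 ?lp_sum_ge0 ?powR_ge0//.
by rewrite -powRrM mulfV ?gt_eqF// powRr1 ?cmod_ge0.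
Qed.

Lemma lp_norm_eq0 p x : 0 < p -> (lp_sum p x < +oo)%E -> lp_norm p x = 0 ->
  forall k, x k = 0.
Proof.
move=> p0 xoo /eqP; rewrite powR_eq0 => /andP[/eqP x0 _] k.
have {}x0 : lp_sum p x = 0%E.
  by rewrite -[LHS]fineK ?x0// ge0_fin_numE ?lp_sum_ge0.
apply: ComplexField.Normc.eq0_normc.
apply/eqP; move/eqP: x0; apply: contraTT => xk0.
rewrite gt_eqF// (@lt_le_trans _ _ (\sum_(0 <= i < k.+1)
    (cmod (x i) `^ p)%:E)%E)//.
  rewrite big_nat_recr//= (@lt_le_trans _ _ (cmod (x k) `^ p)%:E)//.
    by rewrite lte_fin powR_gt0// lt_neqAle eq_sym xk0 cmod_ge0.
  by rewrite leeDr// sume_ge0// => i _; rewrite lee_fin powR_ge0.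
by apply: nneseries_lim_ge => i _; rewrite lee_fin powR_ge0.
Qed.

End lp_sequences.

Definition lp_pred {R : realType} (p : R) : {pred nat -> R[i]} :=
  mem [set x | (lp_sum p x < +oo)%E].

(* The proof of [1 <= p] is a parameter of the type so that the normed module
   structure, which depends on it, is found by unification. *)
Record lp {R : realType} (p : R) (p1 : 1 <= p) :=
  Lp { lp_val :> nat -> R[i]; lp_valP : lp_val \in lp_pred p }.

Section lp_space.
Context {R : realType} (p : R) (p1 : 1 <= p).
Local Notation lp := (lp p1).
Local Notation lp_pred := (lp_pred p).

HB.instance Definition _ := [isSub for @lp_val R p p1].
HB.instance Definition _ := [Choice of lp by <:].

Let p0 : 0 < p. Proof. exact: lt_le_trans p1. Qed.

Lemma lp_predP (x : nat -> R[i]) : reflect (lp_sum p x < +oo)%E (x \in lp_pred).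
Proof. by apply: (iffP idP) => [/set_mem|/mem_set]. Qed.

Lemma lp_submod_closed : submod_closed lp_pred.
Proof.
split; first by apply/lp_predP; rewrite [lp_sum _ _]lp_sum0.
move=> a x y /lp_predP xoo /lp_predP yoo; apply/lp_predP.
have axoo : (lp_sum p (fun k => a * x k)%R < +oo)%E.
  by rewrite lp_sumZ lte_mul_pinfty// lee_fin powR_ge0.
apply: (@lty_poweRy _ _ p^-1); first by rewrite gt_eqF// invr_gt0.
rewrite lp_enormE//; apply: le_lt_trans (lp_minkowski _ _ p1) _.
by rewrite -!lp_normE// ltry.
Qed.

HB.instance Definition _ :=
  GRing.isSubmodClosed.Build R[i] (nat -> R[i]) lp_pred lp_submod_closed.
HB.instance Definition _ := [SubChoice_isSubLmodule of lp by <:].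

Lemma lp_lty (x : lp) : (lp_sum p x < +oo)%E.
Proof. exact/lp_predP/lp_valP. Qed.

Let nm (x : lp) : R[i] := (lp_norm p x)%:C.

Let nmD x y : nm (x + y) <= nm x + nm y.
Proof.
by rewrite /nm -rmorphD/= lecR; exact: lp_normD p1 (lp_lty x) (lp_lty y) (lp_lty (x + y)).
Qed.

Let nmZ (a : R[i]) x : nm (a *: x) = `|a| * nm x.
Proof.
have -> : `|a| = (cmod a)%:C by case: a.
by rewrite /nm -rmorphM/=; congr (_%:C); exact: lp_normZ p0 (lp_lty x).
Qed.

Let nm0_eq0 x : nm x = 0 -> x = 0.
Proof.
move=> /(congr1 (@complex.Re R))/= x0; apply/val_inj/funext => k.
exact: lp_norm_eq0 p0 (lp_lty x) x0 k.
Qed.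

HB.instance Definition _ := Lmodule_isNormed.Build R[i] lp nmD nmZ nm0_eq0.

Lemma lp_normrE (x : lp) : `|x| = (lp_norm p x)%:C.
Proof. by []. Qed.

End lp_space.

Section bounded_operators.
Context {K : numFieldType}.

(* For linear maps, continuity is the same as boundedness
   ([linear_bounded_continuous]). *)
Record bounded_op (V : normedModType K) := BoundedOp {
  bop_fun :> {linear V -> V};
  bop_continuous : continuous bop_fun }.

Definition bounded_invertible (V : normedModType K) (A : V -> V) : Prop :=
  exists S : bounded_op V, cancel A S /\ cancel S A.

Definition spectrum (V : normedModType K) (T : bounded_op V) : set K :=
  [set l | ~ bounded_invertible (fun x => T x - l *: x)].

End bounded_operators.

(* The supremum is taken in the extended reals: an empty spectrum would give
   -oo and an unbounded one +oo. *)
Definition spectral_radius {R : realType} (V : normedModType R[i])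
  (T : bounded_op V) : \bar R := ereal_sup [set (cmod l)%:E | l in spectrum T].

Section weighted_shifts.
Context {R : realType} (p : R) (p1 : 1 <= p).
Variables (w : nat -> R) (wb : bounded_fun w).

(* Sequences are indexed from 0: index k stands for the (k+1)-st entry. *)
Definition fshift_seq (x : nat -> R[i]) : nat -> R[i] :=
  fun n => if n is k.+1 then (w k)%:C * x k else 0.

Definition bshift_seq (x : nat -> R[i]) : nat -> R[i] :=
  fun n => (w n.+1)%:C * x n.+1.

Let p0 : 0 < p. Proof. exact: lt_le_trans p1. Qed.

Lemma weight_bound : exists2 M : R, 0 <= M & forall n, `|w n| <= M.
Proof.
have [M M0 wM] := pinfty_ex_gt0 wb.
by exists M => [|n]; [exact: ltW | exact: wM].
Qed.

Lemma cmodR (a : R) : cmod a%:C = `|a|.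
Proof. by rewrite /= expr0n addr0 sqrtr_sqr. Qed.

Lemma le_cmod_weight (M : R) n (z : R[i]) : 0 <= M -> `|w n| <= M ->
  cmod ((w n)%:C * z) <= cmod (M%:C * z).
Proof.
move=> M0 wM; rewrite !ComplexField.Normc.normcM !cmodR ler_wpM2r ?cmod_ge0//.
by rewrite (ger0_norm M0).
Qed.

Lemma fshift_sum_le (M : R) x : 0 <= M -> (forall n, `|w n| <= M) ->
  (lp_sum p (fshift_seq x) <= (M `^ p)%:E * lp_sum p x)%E.
Proof.
move=> M0 wM; rewrite lp_sum_recl /= !expr0n/= addr0 sqrtr0 powR0 ?gt_eqF//.
rewrite add0e -[in leRHS](ger0_norm M0) -cmodR -lp_sumZ le_lp_sum ?(ltW p0)//.
by move=> k; exact: le_cmod_weight.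
Qed.

Lemma bshift_sum_le (M : R) x : 0 <= M -> (forall n, `|w n| <= M) ->
  (lp_sum p (bshift_seq x) <= (M `^ p)%:E * lp_sum p x)%E.
Proof.
move=> M0 wM; rewrite -[in leRHS](ger0_norm M0) -cmodR -lp_sumZ.
rewrite [leRHS]lp_sum_recl; apply: le_trans (leeDr _ _); last first.
  by rewrite lee_fin powR_ge0.
by rewrite le_lp_sum ?(ltW p0)// => k; exact: le_cmod_weight.
Qed.

Lemma fshift_lp (x : lp p1) : fshift_seq x \in lp_pred p.
Proof.
have [M M0 wM] := weight_bound; apply/lp_predP.
by rewrite (le_lt_trans (fshift_sum_le _ M0 wM))// lte_mul_pinfty ?lp_lty//
  lee_fin powR_ge0.
Qed.

Lemma bshift_lp (x : lp p1) : bshift_seq x \in lp_pred p.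
Proof.
have [M M0 wM] := weight_bound; apply/lp_predP.
by rewrite (le_lt_trans (bshift_sum_le _ M0 wM))// lte_mul_pinfty ?lp_lty//
  lee_fin powR_ge0.
Qed.

Definition fshift_fun (x : lp p1) : lp p1 := Lp p1 (fshift_lp x).

Definition bshift_fun (x : lp p1) : lp p1 := Lp p1 (bshift_lp x).

Lemma fshift_linear : linear fshift_fun.
Proof.
move=> a x y; apply/val_inj/funext => -[|k] /=.
  by rewrite -[RHS]/(a * 0 + 0) mulr0 addr0.
rewrite -[LHS]/((w k)%:C * (a * x k + y k)).
rewrite -[RHS]/(a * ((w k)%:C * x k) + (w k)%:C * y k).
by rewrite mulrDr mulrCA.
Qed.

Lemma bshift_linear : linear bshift_fun.
Proof.
move=> a x y; apply/val_inj/funext => k /=.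
rewrite -[LHS]/((w k.+1)%:C * (a * x k.+1 + y k.+1)).
rewrite -[RHS]/(a * ((w k.+1)%:C * x k.+1) + (w k.+1)%:C * y k.+1).
by rewrite mulrDr mulrCA.
Qed.

HB.instance Definition _ :=
  GRing.isLinear.Build R[i] (lp p1) (lp p1) _ fshift_fun fshift_linear.
HB.instance Definition _ :=
  GRing.isLinear.Build R[i] (lp p1) (lp p1) _ bshift_fun bshift_linear.

Lemma lp_sum_le_continuous (T : {linear lp p1 -> lp p1}) (M : R) : 0 <= M ->
  (forall x, (lp_sum p (T x) <= (M `^ p)%:E * lp_sum p x)%E) -> continuous T.
Proof.
move=> M0 TM; apply/linear_bounded_continuous/bounded_funP => r.
exists (M%:C * r) => x xr; apply: le_trans (ler_wpM2l _ xr); last first.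
  by rewrite -[0]/(0%:C) lecR.
rewrite !lp_normrE -rmorphM/= lecR /lp_norm.
have fx : lp_sum p x \is a fin_num by rewrite ge0_fin_numE ?lp_sum_ge0 ?lp_lty.
have fT : lp_sum p (T x) \is a fin_num.
  by rewrite ge0_fin_numE ?lp_sum_ge0 ?lp_lty.
have <- : (M `^ p) `^ p^-1 = M by rewrite -powRrM mulfV ?gt_eqF// powRr1.
rewrite -powRM ?fine_ge0 ?lp_sum_ge0 ?powR_ge0//.
rewrite ge0_ler_powR ?invr_ge0 ?(ltW p0)// ?nnegrE ?mulr_ge0 ?powR_ge0
  ?fine_ge0 ?lp_sum_ge0//.
by rewrite -lee_fin EFinM (fineK fT) (fineK fx).
Qed.

Lemma fshift_continuous : continuous fshift_fun.
Proof.
have [M M0 wM] := weight_bound.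
apply: (lp_sum_le_continuous M0) => x; exact: (fshift_sum_le x M0 wM).
Qed.

Lemma bshift_continuous : continuous bshift_fun.
Proof.
have [M M0 wM] := weight_bound.
apply: (lp_sum_le_continuous M0) => x; exact: (bshift_sum_le x M0 wM).
Qed.

Definition fshift : bounded_op (lp p1) :=
  @BoundedOp R[i] (lp p1) fshift_fun fshift_continuous.

Definition bshift : bounded_op (lp p1) :=
  @BoundedOp R[i] (lp p1) bshift_fun bshift_continuous.

End weighted_shifts.

(* Main.v *)
From HB Require Import structures.
Require Import Defs.
From mathcomp Require Import all_boot all_order all_algebra.
From mathcomp Require Import complex ring lra.
From mathcomp Require Import all_classical all_reals all_analysis.
Import Order.TTheory GRing.Theory Num.Theory.
Import numFieldNormedType.Exports.
Local Open Scope classical_set_scope.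
Local Open Scope ring_scope.
Local Open Scope complex_scope.

(** The spectrum is squeezed between the point 0 together with the open disc
    of radius [L], and the closed disc of radius [L].

    Outer bound. Let [L < M < |l|]. Only finitely many weights exceed [M], so
    conjugating the shift by a diagonal operator that is bounded with bounded
    inverse replaces [w] by weights of modulus at most [M]
    ([equivalent_weights]). Hence the powers of [T] satisfy
    [|T^k x| <= C M^k |x|] ([weighted_iter_bound]), and the Neumann series
    [- \sum_k T^k / l^(k+1)] inverts [T - l] ([neumann_invertible]); its
    convergence rests on the completeness of [l^p] ([lp_complete]).

    Inner bound. Let [|l| < L] or [l = 0]. For the backward shift, [l] is an
    eigenvalue: the solution of [w_(n+1) v_(n+1) = l v_n], [v_0 = 1], decays
    geometrically because [|l| / w_n] tends to [|l| / L < 1]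
    ([bshift_eigenvalue]). For the forward shift, the first basis vector is
    not in the range of [T - l]: a preimage would satisfy [- l x_0 = 1] and
    [l x_(n+1) = w_n x_n], so that [|x_n|] would be positive and eventually
    nondecreasing ([fshift_not_onto]).

    The point 0 makes the supremum nonnegative, which settles [L = 0]. *)

(** * Limits of real and complex sequences *)

(** The power is differentiable only at positive points; at 0 the sign
    of [f] is essential, since [powR] is 1 at negative arguments. *)
Lemma powR_cvg {R : realType} (f : nat -> R) (a p : R) : 0 < p ->
  (forall n, 0 <= f n) -> f @ \oo --> a -> f n `^ p @[n --> \oo] --> a `^ p.
Proof.
move=> p0 f0 fa.
have : 0 <= a by apply: cvgr_to_ge fa _; apply: nearW.
rewrite le_eqVlt => /predU1P[a0|a0].
  rewrite -a0 powR0 ?gt_eqF//; rewrite -a0 in fa.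
  apply/cvgr0Pnorm_lt => e e0.
  have ep0 : 0 < e `^ p^-1 by rewrite powR_gt0.
  move/cvgr0Pnorm_lt : fa => /(_ _ ep0); apply: filterS => n.
  rewrite !ger0_norm ?powR_ge0// => fn.
  have -> : e = (e `^ p^-1) `^ p by rewrite -powRrM mulVf ?gt_eqF// powRr1 ?ltW.
  by rewrite gt0_ltr_powR ?nnegrE ?(ltW ep0).
have /derivable1_diffP/differentiable_continuous c :
    derivable (@powR R ^~ p) a 1.
  by apply: derivable_powR; rewrite in_itv/= a0.
by apply: (@continuous_cvg _ _ _ _ _ f (@powR R ^~ p) a c).
Qed.

Lemma cmodE {R : realType} (z : R[i]) :
  cmod z = Num.sqrt (complex.Re z ^+ 2 + complex.Im z ^+ 2).
Proof. by case: z. Qed.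

Lemma ler_Re_cmod {R : realType} (z : R[i]) : `|complex.Re z| <= cmod z.
Proof. by rewrite -sqrtr_sqr cmodE ler_sqrt ?lerDl ?addr_ge0 ?sqr_ge0. Qed.

Lemma ler_Im_cmod {R : realType} (z : R[i]) : `|complex.Im z| <= cmod z.
Proof. by rewrite -sqrtr_sqr cmodE ler_sqrt ?lerDr ?addr_ge0 ?sqr_ge0. Qed.

Lemma cauchy_rate_cvg {R : realType} (f b : nat -> R) : b @ \oo --> 0 ->
  (forall m j, (m <= j)%N -> `|f j - f m| <= b m) -> cvgn f.
Proof.
move=> b0 fb; apply: cauchy_cvg; apply: cauchy_exP => e e0.
have [m _ bm] : \forall m \near \oo, b m < e by exact: cvgr_lt b0 _ e0.
exists (f m); exists m => // j /= mj.
by rewrite /ball/= distrC (le_lt_trans (fb _ _ mj))// bm/=.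
Qed.

(** Completeness of the complex numbers, obtained from that of the real and
    imaginary parts. The limit is described through distances to arbitrary
    points, the form in which it is used coordinate by coordinate. *)
Lemma complex_cauchy_rate {R : realType} (u : nat -> R[i]) (b : nat -> R) :
  b @ \oo --> 0 ->
  (forall m j, (m <= j)%N -> cmod (u j - u m) <= b m) ->
  exists z, forall c, cmod (u j - c) @[j --> \oo] --> cmod (z - c).
Proof.
move=> b0 ub.
have /cauchy_rate_cvg cRe : forall m j, (m <= j)%N ->
    `|complex.Re (u j) - complex.Re (u m)| <= b m.
  move=> m j /ub; apply: le_trans; apply: le_trans (ler_Re_cmod _).
  by case: (u j) => ? ?; case: (u m).
have /cauchy_rate_cvg cIm : forall m j, (m <= j)%N ->
    `|complex.Im (u j) - complex.Im (u m)| <= b m.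
  move=> m j /ub; apply: le_trans; apply: le_trans (ler_Im_cmod _).
  by case: (u j) => ? ?; case: (u m).
exists (limn (fun j => complex.Re (u j)) +i* limn (fun j => complex.Im (u j))).
move=> [c d]; rewrite cmodE/=.
rewrite (_ : (fun j => _) = fun j =>
  Num.sqrt ((complex.Re (u j) - c) ^+ 2 + (complex.Im (u j) - d) ^+ 2));
  last by apply/funext => j; case: (u j).
apply: continuous_cvg; first exact: sqrt_continuous.
have cvg_sqrB (f : nat -> R) (e : R) :
    cvgn f -> (f j - e) ^+ 2 @[j --> \oo] --> (limn f - e) ^+ 2.
  move=> cf; rewrite expr2; under eq_fun do rewrite expr2.
  by apply: cvgM; apply: cvgB => //; exact: cvg_cst.
by apply: cvgD; apply: cvg_sqrB; [exact: cRe|exact: cIm].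
Qed.

(** * The Banach space of p-summable sequences *)

Section lp_norm_theory.
Context {R : realType} {p : R} {p1 : 1 <= p}.
Implicit Types (x y : lp p1) (u : nat -> lp p1) (b : nat -> R).

Let p0 : 0 < p. Proof. exact: lt_le_trans p1. Qed.

Lemma lp_norm_ge0 x : 0 <= lp_norm p x.
Proof. exact: powR_ge0. Qed.

Lemma lp_norm_powR x : ((lp_norm p x `^ p)%:E = lp_sum p x)%E.
Proof.
rewrite /lp_norm -powRrM mulVf ?gt_eqF// powRr1 ?fine_ge0 ?lp_sum_ge0//.
by rewrite fineK// ge0_fin_numE ?lp_sum_ge0 ?lp_lty.
Qed.

Lemma le_lp_norm x (b : R) : 0 <= b ->
  (lp_norm p x <= b) = (lp_sum p x <= (b `^ p)%:E)%E.
Proof.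
move=> b0; rewrite -lp_norm_powR lee_fin.
apply/idP/idP => [?|].
  by rewrite ge0_ler_powR ?nnegrE ?lp_norm_ge0 ?(ltW p0).
apply: contraTT; rewrite -!ltNge => ?.
by rewrite gt0_ltr_powR ?nnegrE ?lp_norm_ge0.
Qed.

Lemma lp_sum_leP (f : nat -> R[i]) (B : \bar R) :
  (forall n, (\sum_(0 <= k < n) (cmod (f k) `^ p)%:E <= B)%E) ->
  (lp_sum p f <= B)%E.
Proof.
move=> fB; apply: lime_le; last by apply: nearW => n; exact: fB.
by apply: is_cvg_nneseries => k _ _; rewrite lee_fin powR_ge0.
Qed.

Lemma lp_sum_ge_partial (f : nat -> R[i]) n :
  (\sum_(0 <= k < n) (cmod (f k) `^ p)%:E <= lp_sum p f)%E.
Proof. by apply: nneseries_lim_ge => k _; rewrite lee_fin powR_ge0. Qed.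

Lemma cmod_le_lp_norm x n : cmod (x n) <= lp_norm p x.
Proof.
have : ((cmod (x n) `^ p)%:E <= (lp_norm p x `^ p)%:E)%E.
  rewrite lp_norm_powR; apply: le_trans (lp_sum_ge_partial x n.+1).
  rewrite big_nat_recr//= leeDr// sume_ge0// => k _.
  by rewrite lee_fin powR_ge0.
rewrite lee_fin; apply: contraTT; rewrite -!ltNge => ?.
by rewrite gt0_ltr_powR ?nnegrE ?lp_norm_ge0 ?cmod_ge0.
Qed.

Lemma ler_lp_normD x y : lp_norm p (x + y : lp p1) <= lp_norm p x + lp_norm p y.
Proof. exact: (lp_normD p1 (lp_lty x) (lp_lty y) (lp_lty (x + y))). Qed.

Lemma lp_norm_scale (a : R[i]) x :
  lp_norm p (a *: x : lp p1) = cmod a * lp_norm p x.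
Proof. exact: (lp_normZ a p0 (lp_lty x)). Qed.

Lemma lp_normN x : lp_norm p (- x : lp p1) = lp_norm p x.
Proof.
by rewrite -scaleN1r lp_norm_scale normcN ComplexField.Normc.normc1 mul1r.
Qed.

Lemma lp_norm_0 : lp_norm p (0 : lp p1) = 0.
Proof.
rewrite -(scale0r (0 : lp p1)) lp_norm_scale.
by rewrite ComplexField.Normc.normc0 mul0r.
Qed.

Lemma lp_norm0_eq0 x : lp_norm p x = 0 -> x = 0.
Proof.
move=> x0; apply/val_inj/funext => k; exact: (lp_norm_eq0 p0 (lp_lty x) x0 k).
Qed.

(** The coordinatewise limit exists since each coordinate is Cauchy with the
    same rate [b]. The bound on [u j - u m] passes to finite partial sums of
    the p-th powers, where the limit in [j] can be taken, and then to the whole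
    sum. *)
Lemma lp_complete u b : b @ \oo --> 0 ->
  (forall m j, (m <= j)%N -> lp_norm p (u j - u m : lp p1) <= b m) ->
  exists x, forall m, lp_norm p (x - u m : lp p1) <= b m.
Proof.
move=> b0 ub.
have b_ge0 m : 0 <= b m := le_trans (lp_norm_ge0 _) (ub m m (leqnn m)).
have /choice[x ux] n : exists z : R[i],
    forall c, cmod (u j n - c) @[j --> \oo] --> cmod (z - c).
  apply: (complex_cauchy_rate (fun j => u j n) _ b0) => m j mj.
  exact: le_trans (cmod_le_lp_norm (u j - u m) n) (ub m j mj).
have xu m : (lp_sum p (fun n => x n - u m n)%R <= (b m `^ p)%:E)%E.
  apply: lp_sum_leP => n; rewrite sumEFin lee_fin.
  have c : (\sum_(0 <= k < n) cmod (u j k - u m k)%R `^ p) @[j --> \oo] -->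
      \sum_(0 <= k < n) cmod (x k - u m k) `^ p.
    apply: cvg_big => [|k _]; first exact: add_continuous.
    apply: powR_cvg => // j; exact: cmod_ge0.
  apply: cvgr_to_le c _; exists m => // j /= mj.
  rewrite -lee_fin -sumEFin.
  apply: le_trans (lp_sum_ge_partial (u j - u m : lp p1) n) _.
  by rewrite -le_lp_norm// ub.
(* The limit [x] is built as [(x - u 0) + u 0], a sum of two members. *)
have d_in : (fun n => x n - u 0%N n) \in lp_pred p.
  by apply/lp_predP; rewrite (le_lt_trans (xu 0%N))// ltry.
pose d := Lp p1 d_in.
have xE n : (d + u 0%N : lp p1) n = x n.
  by rewrite -[LHS]/(x n - u 0%N n + u 0%N n) subrK.
exists (d + u 0%N) => m; rewrite le_lp_norm//.
apply: le_trans (xu m); apply: le_lp_sum => [|k]; first exact: ltW.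
by rewrite -xE.
Qed.

End lp_norm_theory.

Lemma lp_of_geometric {R : realType} (p : R) (x : nat -> R[i]) (A q : R) :
  1 <= p -> 0 < q < 1 -> (forall n, cmod (x n) <= A * q ^+ n) ->
  x \in lp_pred p.
Proof.
move=> p1 /andP[q0 q1] xA; have p0 : 0 < p by exact: lt_le_trans p1.
have A0 : 0 <= A.
  by apply: le_trans (cmod_ge0 (x 0%N)) _; rewrite (le_trans (xA 0%N))// mulr1.
have qp1 : q `^ p < 1.
  by rewrite -[ltRHS](congr1 (@^~ p) (powR1 R)) gt0_ltr_powR ?nnegrE ?(ltW q0).
apply/lp_predP; apply: (@le_lt_trans _ _ (A `^ p / (1 - q `^ p))%:E);
  last exact: ltry.
apply: lp_sum_leP => n; rewrite sumEFin lee_fin.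
apply: le_trans (geometric_le_lim n (powR_ge0 _ _) (powR_gt0 _ q0) _);
  last by rewrite ger0_norm ?powR_ge0.
apply: ler_sum_nat => k _ /=.
rewrite -powR_mulrn ?powR_ge0// powRAC powR_mulrn ?(ltW q0)//.
rewrite -powRM ?exprn_ge0 ?(ltW q0)//.
rewrite ge0_ler_powR ?nnegrE ?cmod_ge0 ?(ltW p0)//.
by rewrite mulr_ge0// exprn_ge0// ltW.
Qed.

Lemma le_geometric_le0 {R : realType} (a c q : R) : 0 <= q < 1 ->
  (forall k, a <= c * q ^+ k) -> a <= 0.
Proof.
move=> /andP[q0 q1] acq.
have : geometric c q @ \oo --> 0 by apply: cvg_geometric; rewrite ger0_norm.
by move=> /cvgr_to_ge; apply; apply: nearW.
Qed.

(** * The Neumann series *)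

Section lp_invertibility.
Context {R : realType} {p : R} {p1 : 1 <= p}.
Implicit Types (x y : lp p1).

(** An a priori bound on the solutions makes the inverse bounded directly,
    without the open mapping theorem. *)
Lemma bounded_invertible_of_bound (A : lp p1 -> lp p1) (K : R) : 0 <= K ->
  linear A -> (forall x, A x = 0 -> x = 0) ->
  (forall y, exists2 x, A x = y & lp_norm p x <= K * lp_norm p y) ->
  bounded_invertible A.
Proof.
move=> K0 linA kerA solA.
pose A' : {linear lp p1 -> lp p1} :=
  HB.pack A (GRing.isLinear.Build R[i] (lp p1) (lp p1) _ A linA).
have injA x y : A x = A y -> x = y.
  move=> /eqP; rewrite -subr_eq0 -[_ - _](raddfB A') => /eqP/kerA/eqP.
  by rewrite subr_eq0 => /eqP.
have /choice[S S_] y : exists x, A x = y /\ lp_norm p x <= K * lp_norm p y.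
  by have [x ? ?] := solA y; exists x.
have AS : cancel S A by move=> y; have [] := S_ y.
have SA : cancel A S by move=> x; apply: injA; rewrite AS.
have linS : linear S by move=> a x y; apply: injA; rewrite linA !AS.
pose S' : {linear lp p1 -> lp p1} :=
  HB.pack S (GRing.isLinear.Build R[i] (lp p1) (lp p1) _ S linS).
have cS : continuous S'.
  apply: (@lp_sum_le_continuous _ _ _ S' K K0) => x.
  rewrite -!lp_norm_powR -EFinM -powRM ?lp_norm_ge0// lp_norm_powR -le_lp_norm.
    by have [] := S_ x.
  by rewrite mulr_ge0 ?lp_norm_ge0.
by exists (BoundedOp cS).
Qed.

(** The bound on the powers is the form in which Gelfand's formula expresses
    a spectral radius at most [M]. The constant [C] matters: [T] itself may have
    norm larger than [|l|]. *)
Lemma neumann_invertible (T : bounded_op (lp p1)) (C M : R) (l : R[i]) :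
  0 <= C -> 0 <= M -> M < cmod l ->
  (forall k x, lp_norm p (iter k T x : lp p1) <= C * M ^+ k * lp_norm p x) ->
  bounded_invertible (fun x => T x - l *: x).
Proof.
move=> C0 M0 Ml Tk.
have cl0 : 0 < cmod l by exact: le_lt_trans Ml.
have l0 : l != 0.
  by apply: contraTneq cl0 => ->; rewrite ComplexField.Normc.normc0 ltxx.
(* The ratio of the geometric series dominating the Neumann series. *)
pose q := M / cmod l.
have q01 : 0 <= q < 1 by rewrite divr_ge0 ?(ltW cl0)//= ltr_pdivrMr// mul1r.
have /andP[q0 q1] := q01.
have scaled_iter k y :
    lp_norm p (l ^- k *: iter k T y : lp p1) <= C * lp_norm p y * q ^+ k.
  rewrite lp_norm_scale ComplexField.Normc.normcV.
  have -> : cmod (l ^+ k) = cmod l ^+ k.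
    elim: k => [|k IH]; first by rewrite !expr0 ComplexField.Normc.normc1.
    by rewrite !exprS ComplexField.Normc.normcM IH.
  rewrite ler_pdivrMl ?exprn_gt0//; apply: le_trans (Tk k y) _.
  rewrite le_eqVlt; apply/orP; left; apply/eqP; rewrite /q expr_div_n; field.
  by rewrite expf_neq0 ?gt_eqF.
pose K := C / (cmod l * (1 - q)).
have K0 : 0 <= K by rewrite divr_ge0// mulr_ge0 ?(ltW cl0)// subr_ge0 ltW.
apply: (@bounded_invertible_of_bound _ K K0).
- move=> a x y; rewrite linearP scalerDr scalerBr !scalerA (mulrC a l).
  by rewrite opprD addrACA.
- move=> x /eqP; rewrite subr_eq0 => /eqP Tx; apply: lp_norm0_eq0.
  have iterE k : iter k T x = l ^+ k *: x.
    elim: k => [|k IH]; first by rewrite expr0 scale1r.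
    by rewrite iterS IH linearZ/= Tx scalerA exprSr.
  apply/eqP; rewrite eq_le lp_norm_ge0 andbT.
  apply: (@le_geometric_le0 _ _ (C * lp_norm p x) q q01) => k.
  apply: le_trans (scaled_iter k x); rewrite iterE scalerA mulVf ?scale1r//.
  by rewrite expf_neq0.
move=> y.
(* Partial sums of the Neumann series applied to [y]. *)
pose u m : lp p1 := - \sum_(k < m) (l ^- k.+1 *: iter k T y).
have uS m : u m.+1 = u m - l ^- m.+1 *: iter m T y.
  by rewrite /u big_ord_recr opprD.
have resid m : T (u m) - l *: u m = y - l ^- m *: iter m T y.
  elim: m => [|m IH].
    by rewrite /u big_ord0 oppr0 linear0 scaler0 expr0 invr1 scale1r !subrr.
  rewrite uS linearB linearZ/= scalerBr scalerA opprB addrACA.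
  have -> : l * l ^- m.+1 = l ^- m by rewrite exprS invfM mulrA mulfV// mul1r.
  by rewrite [- _ + _]addrC addrACA addrA -[LHS]addrA IH subrKA.
pose b m : R := K * lp_norm p y * q ^+ m.
have step m : lp_norm p (u m.+1 - u m : lp p1) <= b m * (1 - q).
  rewrite uS addrAC subrr add0r lp_normN exprS invfM -scalerA lp_norm_scale.
  rewrite ComplexField.Normc.normcV ler_pdivrMl//.
  apply: le_trans (scaled_iter m y) _.
  rewrite le_eqVlt; apply/orP; left; apply/eqP.
  rewrite /b /K; field.
  by rewrite subr_eq0 !gt_eqF.
have cauchy_u m i : lp_norm p (u (m + i)%N - u m : lp p1) <= b m * (1 - q ^+ i).
  elim: i => [|i IH].
    by rewrite addn0 !subrr lp_norm_0 mulr0.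
  rewrite addnS -(subrKA (u (m + i)%N)).
  apply: le_trans (ler_lp_normD _ _) _.
  apply: le_trans (lerD (step _) IH) _.
  by rewrite le_eqVlt; apply/orP; left; apply/eqP; rewrite /b exprS exprD; ring.
have b_ge0 m : 0 <= b m.
  apply: mulr_ge0; last exact: exprn_ge0.
  by apply: mulr_ge0 => //; exact: lp_norm_ge0.
have [||x xu] := @lp_complete _ _ _ u b.
- by apply: cvg_geometric; rewrite ger0_norm.
- move=> m j mj; rewrite -(subnKC mj); apply: le_trans (cauchy_u _ _) _.
  by rewrite ler_piMr// gerBl exprn_ge0.
exists x; last first.
  have := xu 0%N; rewrite /b expr0 mulr1.
  by rewrite /u big_ord0 oppr0 subr0.
(* The residual [T x - l x - y] differs from that of [u m] by the image of the
   tail [x - u m], and both are of order [q ^ m]. *)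
apply/eqP; rewrite -subr_eq0; apply/eqP/lp_norm0_eq0/eqP.
rewrite eq_le lp_norm_ge0 andbT.
apply: (@le_geometric_le0 _ _
  ((C * M + cmod l) * (K * lp_norm p y) + C * lp_norm p y) q q01) => m.
have -> : T x - l *: x - y =
    T (x - u m) - l *: (x - u m) - l ^- m *: iter m T y.
  have -> : T (x - u m) - l *: (x - u m) =
      (T x - l *: x) - (T (u m) - l *: u m).
    by rewrite linearB scalerBr !opprD !opprK addrACA.
  by rewrite resid opprB addrA addrAC addrK.
have := scaled_iter m y; rewrite -[in X in X -> _]lp_normN => cm.
apply: le_trans (ler_lp_normD _ _) _; rewrite [leRHS]mulrDl lerD//.
apply: le_trans (ler_lp_normD _ _) _.
rewrite lp_normN lp_norm_scale -mulrA mulrDl lerD//.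
  apply: le_trans (Tk 1%N _) _.
  by rewrite expr1 ler_wpM2l ?xu// mulr_ge0.
by rewrite ler_wpM2l ?xu// ltW.
Qed.

End lp_invertibility.

(** * Diagonally rescaled weights *)

Section weight_equivalence.
Context {R : realType} {p : R} {p1 : 1 <= p}.
Implicit Types (x : lp p1).

Let p0 : 0 < p. Proof. exact: lt_le_trans p1. Qed.

(** Multiplication by [e] is an isomorphism of [l^p] when [e] is bounded and
    bounded away from 0. The hypothesis says that [T] has norm at most [M] for
    the equivalent norm [|e x|]; iterating costs the equivalence constant
    [C / c] only once. *)
Lemma weighted_iter_bound (T : lp p1 -> lp p1) (e : nat -> R) (c C M : R) :
  0 < c -> (forall n, c <= e n <= C) -> 0 <= M ->
  (forall x, (lp_sum p (fun n => (e n)%:C * T x n)%R <=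
     (M `^ p)%:E * lp_sum p (fun n => (e n)%:C * x n)%R)%E) ->
  forall k x, lp_norm p (iter k T x : lp p1) <= C / c * M ^+ k * lp_norm p x.
Proof.
move=> c0 eC M0 eT k x.
have C0 : 0 <= C.
  have /andP[ce eC0] := eC 0%N.
  by rewrite (le_trans _ eC0)// (le_trans _ ce)// ltW.
have e0 n : 0 <= e n by have /andP[ce _] := eC n; rewrite (le_trans _ ce)// ltW.
have iterE : (lp_sum p (fun n => (e n)%:C * iter k T x n)%R <=
     ((M ^+ k) `^ p)%:E * lp_sum p (fun n => (e n)%:C * x n)%R)%E.
  elim: k => [|k IH]; first by rewrite expr0 powR1 mul1e.
  rewrite exprS powRM ?exprn_ge0// EFinM -muleA.
  apply: le_trans (eT _) _.
  by rewrite lee_wpmul2l// lee_fin powR_ge0.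
have lower : ((c `^ p)%:E * lp_sum p (iter k T x) <=
    lp_sum p (fun n => (e n)%:C * iter k T x n)%R)%E.
  rewrite -[c]ger0_norm ?(ltW c0)// -cmodR -lp_sumZ; apply: le_lp_sum => [|n].
    exact: ltW.
  rewrite !ComplexField.Normc.normcM !cmodR ler_wpM2r ?cmod_ge0//.
  by rewrite !ger0_norm ?(ltW c0)//; have /andP[] := eC n.
have upper : (lp_sum p (fun n => (e n)%:C * x n)%R <=
    (C `^ p)%:E * lp_sum p x)%E.
  rewrite -[C]ger0_norm// -cmodR -lp_sumZ; apply: le_lp_sum => [|n].
    exact: ltW.
  rewrite !ComplexField.Normc.normcM !cmodR ler_wpM2r ?cmod_ge0//.
  by rewrite !ger0_norm//; have /andP[] := eC n.
rewrite le_lp_norm ?mulr_ge0 ?lp_norm_ge0 ?exprn_ge0 ?invr_ge0 ?(ltW c0)//.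
rewrite -(@lee_pmul2l _ (c `^ p)%:E) ?lte_fin ?powR_gt0//.
apply: le_trans lower _; apply: le_trans iterE _.
have : (((M ^+ k) `^ p)%:E * lp_sum p (fun n => (e n)%:C * x n)%R <=
   ((M ^+ k) `^ p)%:E * ((C `^ p)%:E * lp_sum p x))%E.
  by rewrite lee_wpmul2l// lee_fin powR_ge0.
move=> /le_trans; apply; rewrite -lp_norm_powR -!EFinM lee_fin.
rewrite -!powRM ?mulr_ge0 ?lp_norm_ge0 ?exprn_ge0 ?invr_ge0 ?(ltW c0)//.
rewrite le_eqVlt; apply/orP; left; apply/eqP; congr (_ `^ _); field.
by rewrite gt_eqF.
Qed.

End weight_equivalence.

(** The weights [w n * d n / d n.+1] are those of the shift conjugated by the
    diagonal [d]. The sequence [d] absorbs the excess of [w n] over [M]; since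
    the excess occurs finitely often, [d] is eventually constant. *)
Lemma equivalent_weights {R : realType} (w : nat -> R) (L M : R) :
  (forall n, 0 <= w n) -> w @ \oo --> L -> L < M -> 0 < M ->
  exists (d : nat -> R) (C : R), forall n,
    [/\ 1 <= d n, d n <= C & `|w n * d n / d n.+1| <= M].
Proof.
move=> w0 wL LM M0.
pose d := fix d n := if n is k.+1 then d k * Num.max 1 (w k / M) else 1 : R.
have dS n : d n.+1 = d n * Num.max 1 (w n / M) by [].
have d1 n : 1 <= d n.
  elim: n => [|n IH]; first exact: lexx.
  by rewrite dS -[leLHS]mulr1 ler_pM// le_max lexx.
clearbody d.
have d0 n : 0 < d n by exact: lt_le_trans (d1 n).
have [N _ wM] : \forall n \near \oo, w n <= M by exact: cvgr_le wL _ LM.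
have d_ge k : d N = d (N + k)%N.
  elim: k => [|k IH]; first by rewrite addn0.
  rewrite addnS dS -IH max_l ?mulr1// ler_pdivrMr// mul1r.
  by apply: wM; rewrite /= leq_addr.
have d_nd : {homo d : m n / (m <= n)%N >-> m <= n}.
  apply: homo_leq => // [|n]; first exact: le_trans.
  by rewrite dS ler_peMr ?(ltW (d0 n))// le_max lexx.
exists d, (d N) => n; split => //.
  case: (leqP n N) => [|/ltnW nN]; first exact: d_nd.
  by rewrite -(subnKC nN) -d_ge.
rewrite ger0_norm ?divr_ge0 ?mulr_ge0 ?(ltW (d0 _))// dS.
rewrite ler_pdivrMr; last by rewrite mulr_gt0// lt_max ltr01.
rewrite mulrCA mulrC ler_wpM2l ?(ltW (d0 _))//.
by rewrite -ler_pdivrMl// mulrC le_max lexx orbT.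
Qed.

(** * The spectrum of the shifts *)

Section shift_spectrum.
Context {R : realType} {p : R} {p1 : 1 <= p}.
Context {w : nat -> R} {wb : bounded_fun w} {L : R}.
Hypothesis w_gt0 : forall n, 0 < w n.
Hypothesis wL : w @ \oo --> L.
Implicit Types (l : R[i]).

Let p0 : 0 < p. Proof. exact: lt_le_trans p1. Qed.

Lemma weight_lim_ge0 : 0 <= L.
Proof. by apply: cvgr_to_ge wL _; apply: nearW => n; exact: ltW. Qed.

Lemma between_lim l : L < cmod l -> exists M, [/\ L < M, 0 < M & M < cmod l].
Proof.
have := weight_lim_ge0; exists ((L + cmod l) / 2); split; lra.
Qed.

(** The forward shift moves entry [n] to entry [n.+1] with factor [w n], so
    dividing entries by [d] turns the factor into [w n * d n / d n.+1]. *)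
Lemma fshift_resolvent l : L < cmod l -> ~ spectrum (fshift p1 wb) l.
Proof.
move=> /between_lim[M [LM M0 Ml]]; apply.
have [d [C dC]] := equivalent_weights w L M (fun n => ltW (w_gt0 n)) wL LM M0.
have d0 n : 0 < d n by have [d1 _ _] := dC n; exact: lt_le_trans d1.
have C0 : 0 < C by have [_ dC0 _] := dC 0%N; exact: lt_le_trans dC0.
apply: (@neumann_invertible _ _ _ _ (1 / C^-1) M) => //; rewrite ?ltW//.
  by rewrite divr_gt0// invr_gt0.
apply: (@weighted_iter_bound _ _ _ _ (fun n => (d n)^-1)).
- by rewrite invr_gt0.
- move=> n; have [d1 dC0 _] := dC n.
  by rewrite lef_pV2 ?posrE// dC0 invf_le1.
- exact: ltW.
move=> x; pose w' n := w n * d n / d n.+1.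
have -> : (fun n => ((d n)^-1)%:C * fshift p1 wb x n) =
    fshift_seq w' (fun n => ((d n)^-1)%:C * x n).
  apply/funext => -[|n] /=; first by rewrite mulr0.
  rewrite !mulrA -!rmorphM/=; congr (_%:C * _).
  by rewrite /w'; field; rewrite !gt_eqF.
by apply: (fshift_sum_le p1 _ (ltW M0)) => n; have [] := dC n.
Qed.

(** Here entry [n.+1] moves to entry [n] with factor [w n.+1], so the entries
    are multiplied by [d], with the index advanced by one, to produce the same
    rescaled weights. *)
Lemma bshift_resolvent l : L < cmod l -> ~ spectrum (bshift p1 wb) l.
Proof.
move=> /between_lim[M [LM M0 Ml]]; apply.
have [d [C dC]] := equivalent_weights w L M (fun n => ltW (w_gt0 n)) wL LM M0.
have d0 n : 0 < d n by have [d1 _ _] := dC n; exact: lt_le_trans d1.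
have C0 : 0 < C by have [_ dC0 _] := dC 0%N; exact: lt_le_trans dC0.
apply: (@neumann_invertible _ _ _ _ (C / 1) M) => //; rewrite ?ltW//.
  by rewrite divr_gt0.
apply: (@weighted_iter_bound _ _ _ _ (fun n => d n.+1)) => //.
- by move=> n; have [-> ->] := dC n.+1.
- exact: ltW.
move=> x; pose w' n := w n * d n / d n.+1.
have -> : (fun n => (d n.+1)%:C * bshift p1 wb x n) =
    bshift_seq w' (fun n => (d n.+1)%:C * x n).
  apply/funext => n /=.
  rewrite /bshift_seq !mulrA -!rmorphM/=; congr (_%:C * _).
  by rewrite /w'; field; rewrite !gt_eqF.
by apply: (bshift_sum_le p1 _ (ltW M0)) => n; have [] := dC n.
Qed.

(** The moduli of the entries of the eigenvector are the products of the ratios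
    [|l| / w n.+1]. After the rescaling of [equivalent_weights] all these ratios
    are at most some [q < 1], which gives geometric decay. *)
Lemma bshift_eigenvalue l : cmod l < L \/ l = 0 -> spectrum (bshift p1 wb) l.
Proof.
move=> lL.
have w0 n : (w n)%:C != 0 by rewrite -[0]/(0%:C) (inj_eq (@complexI _)) gt_eqF.
pose v := fix v n := if n is k.+1 then l * v k / (w k.+1)%:C else 1 : R[i].
have v0 : v 0%N = 1 by [].
have vS n : v n.+1 = l * v n / (w n.+1)%:C by [].
clearbody v.
(* If [L = 0] then [l = 0] and the ratios vanish; [cmod l / L] is then 0. *)
have ratioL : (fun n => cmod l / w n.+1) @ \oo --> cmod l / L.
  have [L0|L0] := eqVneq L 0; last first.
    by apply: cvgMr; apply: cvgV => //; rewrite cvg_shiftS.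
  have l0 : cmod l = 0.
    case: lL => [|->]; last exact: ComplexField.Normc.normc0.
    by rewrite L0 ltNge cmod_ge0.
  by rewrite l0 mul0r; under eq_fun do rewrite mul0r; exact: cvg_cst.
have ratio1 : cmod l / L < 1.
  case: lL => [lL|->]; last by rewrite ComplexField.Normc.normc0 mul0r.
  by rewrite ltr_pdivrMr ?mul1r// (le_lt_trans _ lL)// cmod_ge0.
pose q := (cmod l / L + 1) / 2.
have lq : cmod l / L < q by rewrite /q; lra.
have ratio0 : 0 <= cmod l / L by rewrite divr_ge0 ?cmod_ge0// weight_lim_ge0.
have q0 : 0 < q by rewrite /q; lra.
have q1 : q < 1 by rewrite /q; lra.
have [|d [C dC]] := equivalent_weights _ _ _ _ ratioL lq q0.
  by move=> n; rewrite divr_ge0 ?cmod_ge0// ltW.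
have d0 n : 0 < d n by have [d1 _ _] := dC n; exact: lt_le_trans d1.
have vd n : cmod (v n) <= d n * q ^+ n.
  elim: n => [|n IH].
    rewrite v0 ComplexField.Normc.normc1 expr0 mulr1.
    by have [] := dC 0%N.
  rewrite vS !ComplexField.Normc.normcM ComplexField.Normc.normcV cmodR.
  rewrite (gtr0_norm (w_gt0 _)) mulrAC.
  have r0 : 0 <= cmod l / w n.+1 by rewrite divr_ge0 ?cmod_ge0// ltW.
  apply: le_trans (ler_wpM2l r0 IH) _.
  rewrite mulrA exprS mulrA ler_wpM2r ?exprn_ge0 ?(ltW q0)//.
  rewrite [leRHS]mulrC -ler_pdivrMr//.
  by have [_ _] := dC n; apply: le_trans; exact: ler_norm.
have v_lp : v \in lp_pred p.
  apply: (@lp_of_geometric _ _ _ C q) => //; first by rewrite q0.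
  move=> n; apply: le_trans (vd n) _.
  by rewrite ler_wpM2r ?exprn_ge0 ?(ltW q0)//; have [] := dC n.
pose x := Lp p1 v_lp.
move=> [S [cS _]].
have x0 : x = 0.
  rewrite -(cS x) -[RHS](linear0 S); congr (S _); apply/eqP.
  rewrite subr_eq0; apply/eqP/val_inj/funext => n.
  by rewrite -[LHS]/((w n.+1)%:C * v n.+1) -[RHS]/(l * v n) vS mulrC divfK.
have nx : lp_norm p x = 0 by rewrite x0 lp_norm_0.
have := cmod_le_lp_norm x 0%N.
by rewrite nx -[x 0%N]/(v 0%N) v0 ComplexField.Normc.normc1 ler10.
Qed.

(** A preimage of the first basis vector under [T - l] would satisfy
    [- l x_0 = 1] and [l x_(n+1) = w_n x_n]. This excludes [l = 0], and for
    [0 < |l| < L] it keeps the entries away from 0, against p-summability. *)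
Lemma fshift_not_onto l : cmod l < L \/ l = 0 -> spectrum (fshift p1 wb) l.
Proof.
move=> lL [S [_ cS]].
have e_lp : (fun n => (n == 0)%:R : R[i]) \in lp_pred p.
  apply: (@lp_of_geometric _ _ _ 1 2^-1) => //.
    by rewrite invr_gt0 invf_lt1 ?ltr0n// ltr1n.
  move=> [|n]; first by rewrite ComplexField.Normc.normc1 expr0 mulr1.
  by rewrite ComplexField.Normc.normc0 mul1r exprn_ge0// invr_ge0 ler0n.
pose e := Lp p1 e_lp; pose x := S e.
have xE n : fshift_seq w x n - l * x n = (n == 0%N)%:R.
  by rewrite -[RHS]/(e n) -[in RHS](cS e).
have x0 : - (l * x 0%N) = 1 by rewrite -sub0r; exact: (xE 0%N).
have xS n : (w n)%:C * x n = l * x n.+1.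
  by apply/eqP; rewrite -subr_eq0; apply/eqP; exact: (xE n.+1).
have l0 : l != 0.
  by apply: contra_eq_neq x0 => ->; rewrite mul0r oppr0 eq_sym oner_eq0.
have {}lL : cmod l < L by case: lL => // l0'; rewrite l0' eqxx in l0.
have cl0 : 0 < cmod l.
  rewrite lt_neqAle cmod_ge0 andbT eq_sym.
  by apply: contra_neq l0 => /ComplexField.Normc.eq0_normc.
have cxS n : w n * cmod (x n) = cmod l * cmod (x n.+1).
  rewrite -ComplexField.Normc.normcM -xS ComplexField.Normc.normcM cmodR.
  by rewrite gtr0_norm.
have cx0 n : 0 < cmod (x n).
  elim: n => [|n IH]; last by rewrite -(pmulr_rgt0 _ cl0) -cxS mulr_gt0.
  rewrite -(pmulr_rgt0 _ cl0) -ComplexField.Normc.normcM -normcN x0.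
  by rewrite ComplexField.Normc.normc1.
(* From [N] on, [|x_(n+1)| = (w_n / |l|) |x_n| >= |x_n|]. *)
have [N _ wl] : \forall n \near \oo, cmod l <= w n by exact: cvgr_ge wL _ lL.
have x_ge k : cmod (x N) <= cmod (x (N + k)%N).
  elim: k => [|k IH]; first by rewrite addn0.
  apply: le_trans IH _; rewrite addnS -(ler_pM2l cl0) -cxS ler_pM2r//.
  by apply: wl; rewrite /= leq_addr.
have sum_ge k : k%:R * cmod (x N) `^ p <= \sum_(0 <= j < N + k) cmod (x j) `^ p.
  elim: k => [|k IH].
    by rewrite mul0r sumr_ge0// => j _; exact: powR_ge0.
  rewrite addnS big_nat_recr//= -natr1 mulrDl mul1r lerD//.
  by rewrite ge0_ler_powR ?nnegrE ?cmod_ge0 ?(ltW p0).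
have c0 : 0 < cmod (x N) `^ p by rewrite powR_gt0.
have bound k : k%:R * cmod (x N) `^ p <= lp_norm p x `^ p.
  apply: le_trans (sum_ge k) _; rewrite -lee_fin lp_norm_powR -sumEFin.
  exact: lp_sum_ge_partial.
have := bound (Num.Def.archi_bound (lp_norm p x `^ p / cmod (x N) `^ p)).
rewrite leNgt -ltr_pdivrMr// archi_boundP//.
by rewrite divr_ge0 ?powR_ge0.
Qed.

End shift_spectrum.

Theorem proposition3p1p1 (R : realType) (p : R) (p1 : 1 <= p)
    (w : nat -> R) (wb : bounded_fun w) (w_gt0 : forall n, 0 < w n)
    (L : R) (wL : w n @[n --> \oo] --> L)
    (T : bounded_op (lp p1)) :
  T = fshift p1 wb \/ T = bshift p1 wb ->
  spectral_radius T = L%:E.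
Proof.
move=> TFB.
have outer l : spectrum T l -> cmod l <= L.
  move=> sl; rewrite leNgt; apply/negP => Ll.
  case: TFB sl => ->; first exact: (fshift_resolvent w_gt0 wL).
  exact: (bshift_resolvent w_gt0 wL).
have inner l : cmod l < L \/ l = 0 -> spectrum T l.
  case: TFB => ->; first exact: (fshift_not_onto w_gt0 wL).
  exact: (bshift_eigenvalue w_gt0 wL).
have mem_le l : spectrum T l -> ((cmod l)%:E <= spectral_radius T)%E.
  by move=> sl; apply: ereal_sup_ubound; exists l.
apply/eqP; rewrite eq_le; apply/andP; split.
  by apply: ge_ereal_sup => _ [l sl <-]; rewrite lee_fin outer.
(* If the supremum were some [r < L], the midpoint of [r] and [L] would be a
   spectral value beyond it. *)
rewrite leNgt; apply/negP; have := mem_le 0 (inner 0 (or_intror erefl)).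
rewrite ComplexField.Normc.normc0.
case: (spectral_radius T) mem_le => [r|//|//] mem_le.
rewrite lee_fin lte_fin => r0 rL.
have t0 : 0 <= (r + L) / 2 by lra.
have := mem_le ((r + L) / 2)%:C; rewrite cmodR ger0_norm// lee_fin => tr.
have /tr : spectrum T ((r + L) / 2)%:C.
  by apply: inner; left; rewrite cmodR ger0_norm//; lra.
lra.
Qed.
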